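(* Let $K$ be any field and let $\mathbf Q=\bigoplus_{n_1,n_2,n_3\ge0}\mathbf Q_{n_1n_2n_3}$ be the $\mathbb N_0^3$-grading of the Lie superalgebra $\mathbf Q=\mathrm{Lie}(v_0,v_1,v_2)$ by multidegree in the generators $v_0,v_1,v_2$. Then $\dim_K\mathbf Q_{n_1n_2n_3}\le 1$ for all $n_1,n_2,n_3\ge 0$.
   Context: $\Lambda$ is the Grassmann algebra over $K$ on odd generators $x_0,x_1,\dots$; $x_i$ is identified with left multiplication; $\partial_i$ is the odd superderivation with $\partial_i(x_j)=\delta_{ij}$; pivot elements $v_i=\sum_{k\ge0}\big(\prod_{n=0}^{k-1}x_{i+3n}x_{i+3n+1}\big)\partial_{i+3k}$. $\mathbf Q$ is the Lie subsuperalgebra of $(\operatorname{End}\Lambda)^{(-)}$ (supercommutator) generated by $v_0,v_1,v_2$ (in characteristic $2$ also closed under squaring of odd elements). $\mathbf Q_{n_1n_2n_3}$ is the span of all Lie products (including squares) in which $v_0,v_1,v_2$ occur $n_1,n_2,n_3$ times respectively; $\mathbf Q$ is the direct sum of these subspaces. *)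

(* Defs.v *)
(* Grassmann algebra modelled with multinomials' monoid-algebra
   type {malg K[{fset nat}]} (finitely supported K-valued functions on finite
   sets of indices = the standard basis x_{j1} ... x_{jk}, j1 < ... < jk). *)
From HB Require Import structures.
From mathcomp Require Import all_boot all_order all_algebra.
From mathcomp Require Import finmap.
From mathcomp Require Import monalg.
Set Implicit Arguments. Unset Strict Implicit. Unset Printing Implicit Defensive.
Import GRing.Theory.
Local Open Scope ring_scope.
Local Open Scope fset_scope.

Section Grassmann.
Variable K : fieldType.

(* Basis monomials: finite sets m of indices; m stands for x_{j1} x_{j2} ... x_{jk}
   with j1 < j2 < ... < jk the elements of m. *)
Definition mon := {fset nat}.

Definition Lam := {malg K[mon]}.

Definition op := Lam -> Lam.

Definition gsign (i : nat) (m : mon) : K :=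
  (-1) ^+ #|` [fset j in m | (j < i)%N]|.

Definition linext (phi : mon -> Lam) : op :=
  fun f => \sum_(m <- msupp f) f@_m *: phi m.

(* x_i, identified with left multiplication by x_i:
   x_i * x_m = (-1)^{#{j in m, j<i}} x_{m u {i}} if i notin m, 0 otherwise *)
Definition xmul (i : nat) : op :=
  linext (fun m => if i \in m then 0 else << gsign i m *g (i |` m) >>).

(* d_i : the odd superderivation with d_i(x_j) = delta_ij:
   d_i(x_m) = (-1)^{#{j in m, j<i}} x_{m \ {i}} if i in m, 0 otherwise *)
Definition dpart (i : nat) : op :=
  linext (fun m => if i \in m then << gsign i m *g (m `\ i) >> else 0).

Fixpoint xprod (i k : nat) : op :=
  match k with
  | 0 => fun f => f
  | k'.+1 => fun f => xprod i k' (xmul (i + 3 * k') (xmul (i + 3 * k' + 1) f))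
  end.

(* a bound N f with: every index occurring in f is < N f; hence d_{i+3k} f = 0 for
   k >= N f, so the infinite sum defining v_i is finite on each f. *)
Definition idx_bound (f : Lam) : nat :=
  (\max_(m <- msupp f) \max_(j <- m) j.+1)%N.

(* pivot elements v_i = sum_{k>=0} (prod_{n<k} x_{i+3n} x_{i+3n+1}) d_{i+3k} *)
Definition pivot (i : nat) : op :=
  fun f => \sum_(k < idx_bound f) xprod i k (dpart (i + 3 * k) f).

Inductive lexpr : Type :=
  | LGen of 'I_3
  | LBr of lexpr & lexpr
  | LSq of lexpr.

Fixpoint lcount (i : 'I_3) (e : lexpr) : nat :=
  match e with
  | LGen j => (i == j)%N
  | LBr a b => (lcount i a + lcount i b)%N
  | LSq a => (2 * lcount i a)%N
  end.

Definition ltotal (e : lexpr) : nat :=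
  (\sum_(i < 3) lcount i e)%N.

(* parity: each v_i is odd, so a Lie monomial has parity = total degree mod 2 *)
Definition lodd (e : lexpr) : bool := odd (ltotal e).

Fixpoint lwf (e : lexpr) : bool :=
  match e with
  | LGen _ => true
  | LBr a b => lwf a && lwf b
  | LSq a => lwf a && lodd a
  end.

Fixpoint leval (e : lexpr) : op :=
  match e with
  | LGen i => pivot i
  | LBr a b => fun f => leval a (leval b f)
                        - (-1) ^+ (lodd a && lodd b) *: leval b (leval a f)
  | LSq a => fun f => leval a (leval a f)
  end.

Definition Qgr (n1 n2 n3 : nat) (u : op) : Prop :=
  exists s : seq (K * lexpr),
    all (fun p : K * lexpr => [&& lwf p.2, lcount 0 p.2 == n1,
                                   lcount 1 p.2 == n2 & lcount 2 p.2 == n3]) s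
    /\ u = (fun f => \sum_(p <- s) p.1 *: leval p.2 f).

Definition dim_le1 (P : op -> Prop) : Prop :=
  exists w : op, forall u, P u -> exists c : K, u = (fun f => c *: w f).

End Grassmann.

(* Main.v *)
Require Import Defs.
From HB Require Import structures.
From mathcomp Require Import all_boot all_order all_algebra.
From mathcomp Require Import finmap monalg.
From mathcomp Require Import zify ring.
From Stdlib Require Import Classical FunctionalExtensionality.

(* The recursion v_i = d_i + x_i x_(i+1) v_(i+3) and the anticommutation of v_i
   with x_j, d_j for j < i show that every Lie monomial in v_0, v_1, v_2 is a
   scalar multiple of a single monomial x_w v_l, where w is a set of indices
   below l - 1 not containing both l - 3 and l - 2.  Giving x_i the opposite of
   the weight of v_i, the recursion becomes wt v_(i+3) = 2 wt v_i + wt v_(i+1),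
   so that multidegrees live in Z[t] / (t^3 - t - 2) with wt v_i = t^i, and the
   multidegree of x_w v_l is t^l minus the sum of t^j over j in w.  Since
   Z[t] / (t) has two elements, the digits of such an expansion can be read off
   one after the other, so the multidegree determines (w, l). *)

Set Implicit Arguments.
Unset Strict Implicit.
Unset Printing Implicit Defensive.

Import GRing.Theory.
Local Open Scope fset_scope.
Local Open Scope ring_scope.

(** * The Grassmann algebra and pivot elements *)

Section Signs.
Variable K : fieldType.

Lemma gsignU1 i j m : j \notin m ->
  gsign K i (j |` m) = (-1) ^+ (j < i)%N * gsign K i m.
Proof.
move=> jm; rewrite /gsign.
have -> : [fset k in j |` m | (k < i)%N] =
    if (j < i)%N then j |` [fset k in m | (k < i)%N]
    else [fset k in m | (k < i)%N].
  apply/fsetP => k; case: ifP => ji; rewrite !inE /=.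
    by case: eqVneq => [->|_] //=; rewrite ji.
  by case: eqVneq => [->|_] //=; rewrite ji andbF.
case: ifP => ji; last by rewrite mul1r.
by rewrite cardfsU1 !inE (negPf jm) /= exprD.
Qed.

Lemma gsignD1 i j m : j \in m ->
  gsign K i (m `\ j) = (-1) ^+ (j < i)%N * gsign K i m.
Proof.
move=> jm; rewrite -{2}(fsetD1K jm) gsignU1; last by rewrite !inE eqxx.
by rewrite mulrA -expr2 sqrr_sign mul1r.
Qed.

Lemma gsign_sqr i m : gsign K i m * gsign K i m = 1.
Proof. by rewrite -expr2 /gsign sqrr_sign. Qed.

Lemma ltn_sign_swap (i j : nat) : i != j ->
  (-1) ^+ (j < i)%N = - (-1) ^+ (i < j)%N :> K.
Proof. by rewrite neq_ltn => /orP[] ij; rewrite ij ltnNge ltnW //= ?opprK. Qed.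

End Signs.

(** * Canonical anticommutation relations, checked on basis monomials *)

Section Relations.
Variables (K : fieldType) (V : lmodType K) (e : mon -> V).
Variables X D : nat -> {linear V -> V}.
Hypothesis XE : forall i m,
  X i (e m) = if i \in m then 0 else gsign K i m *: e (i |` m).
Hypothesis DE : forall i m,
  D i (e m) = if i \in m then gsign K i m *: e (m `\ i) else 0.

Let XE1 i m : i \in m -> X i (e m) = 0.
Proof. by rewrite XE => ->. Qed.
Let XE0 i m : i \notin m -> X i (e m) = gsign K i m *: e (i |` m).
Proof. by rewrite XE => /negPf->. Qed.
Let DE1 i m : i \in m -> D i (e m) = gsign K i m *: e (m `\ i).
Proof. by rewrite DE => ->. Qed.
Let DE0 i m : i \notin m -> D i (e m) = 0.
Proof. by rewrite DE => /negPf->. Qed.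

Lemma basis_X_X i m : X i (X i (e m)) = 0.
Proof.
have [im|im] := boolP (i \in m); first by rewrite XE1 // linear0.
by rewrite XE0 // linearZ /= XE1 ?scaler0 // fset1U1.
Qed.

Lemma basis_XC i j m : X i (X j (e m)) = - X j (X i (e m)).
Proof.
have [<-|ij] := eqVneq i j; first by rewrite basis_X_X oppr0.
have ji : j != i by rewrite eq_sym.
have [im|im] := boolP (i \in m); have [jm|jm] := boolP (j \in m).
- by rewrite !XE1 // !linear0.
- by rewrite XE0 // linearZ /= !XE1 ?inE ?im ?orbT // scaler0 !linear0.
- by rewrite (XE1 jm) XE0 // linearZ /= XE1 ?inE ?jm ?orbT // scaler0 !linear0.
rewrite !XE0 // !linearZ /= !XE0 ?inE ?negb_or ?ij ?ji //.
rewrite !gsignU1 // ?scalerN !scalerA fsetUCA -scaleNr (ltn_sign_swap K ij).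
by congr (_ *: _); ring.
Qed.

Lemma basis_D_D i m : D i (D i (e m)) = 0.
Proof.
have [im|im] := boolP (i \in m); last by rewrite DE0 // linear0.
by rewrite DE1 // linearZ /= DE0 ?scaler0 // !inE eqxx.
Qed.

Lemma basis_DC i j m : D i (D j (e m)) = - D j (D i (e m)).
Proof.
have [<-|ij] := eqVneq i j; first by rewrite basis_D_D oppr0.
have ji : j != i by rewrite eq_sym.
have [im|im] := boolP (i \in m); have [jm|jm] := boolP (j \in m).
- rewrite !DE1 // !linearZ /= !DE1 ?inE ?ij ?ji //.
  rewrite !gsignD1 // ?scalerN !scalerA !fsetDDl [[fset i] `|` _]fsetUC -scaleNr.
  by rewrite (ltn_sign_swap K ij); congr (_ *: _); ring.
- by rewrite (DE0 jm) DE1 // linearZ /= DE0 ?inE ?ji // scaler0 !linear0.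
- by rewrite (DE0 im) DE1 // linearZ /= DE0 ?inE ?ij // scaler0 !linear0.
by rewrite !DE0 // !linear0.
Qed.

Lemma basis_D_X i m : D i (X i (e m)) = e m - X i (D i (e m)).
Proof.
have [im|im] := boolP (i \in m).
  rewrite XE1 // DE1 // linearZ linear0 /= XE0 ?inE ?eqxx // gsignD1 //.
  by rewrite ltnn mul1r ?scalerN scalerA gsign_sqr scale1r fsetD1K // subrr.
rewrite XE0 // DE0 // linearZ linear0 ?subr0 ?addr0 /= DE1 ?fset1U1 // gsignU1 //.
by rewrite ltnn mul1r ?scalerN scalerA gsign_sqr scale1r fsetU1K.
Qed.

Lemma basis_D_X_neq i j m : i != j -> D i (X j (e m)) = - X j (D i (e m)).
Proof.
move=> ij; have ji : j != i by rewrite eq_sym.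
have [im|im] := boolP (i \in m); have [jm|jm] := boolP (j \in m).
- by rewrite XE1 // DE1 // linearZ linear0 /= XE1 ?oppr0 ?scaler0 ?oppr0 // !inE ji.
- rewrite XE0 // DE1 // !linearZ /= XE0 ?DE1 ?inE ?negb_and ?jm ?im ?orbT //.
  rewrite gsignU1 // gsignD1 // ?scalerN !scalerA -scaleNr.
  have -> : (j |` m) `\ i = j |` (m `\ i).
    apply/fsetP => k; rewrite !inE.
    by have [->|_] := eqVneq k j; rewrite ?ji.
  by rewrite (ltn_sign_swap K ij); congr (_ *: _); ring.
- by rewrite XE1 // DE0 // !linear0.
by rewrite XE0 // DE0 // linearZ linear0 /= DE0 ?oppr0 ?scaler0 ?oppr0 // !inE negb_or ij.
Qed.

End Relations.

(** All brackets are computed from these relations alone. The recursion [ps_vE] replaces the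
    infinite sum, and [ps_vx], [ps_vd] reflect that v_i involves only indices at least i. *)
Record pivot_system (K : fieldType) (V : lmodType K)
    (x d v : nat -> {linear V -> V}) : Prop := PivotSystem {
  ps_xx : forall i f, x i (x i f) = 0;
  ps_xC : forall i j f, x i (x j f) = - x j (x i f);
  ps_dd : forall i f, d i (d i f) = 0;
  ps_dx : forall i f, d i (x i f) = f - x i (d i f);
  ps_dx_neq : forall i j f, i != j -> d i (x j f) = - x j (d i f);
  ps_vE : forall i f, v i f = d i f + x i (x i.+1 (v i.+3 f));
  ps_vx : forall i j f, (j < i)%N -> v i (x j f) = - x j (v i f);
  ps_vd : forall i j f, (j < i)%N -> v i (d j f) = - d j (v i f)
}.

(** * The operators on the Grassmann algebra *)

Section Operators.
Variable K : fieldType.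
Implicit Types (f g : Lam K) (m : mon) (phi : mon -> Lam K).

Lemma linextEw phi f (D : {fset mon}) :
  msupp f `<=` D -> linext phi f = \sum_(m <- D) f@_m *: phi m.
Proof.
move=> le_fD; rewrite /linext (big_fset_incl _ le_fD) //= => m _ /mcoeff_outdom ->.
by rewrite scale0r.
Qed.

Lemma linext_linear phi : linear (linext phi).
Proof.
move=> c f g; pose D := msupp f `|` msupp g.
have fD : msupp f `<=` D by exact: fsubsetUl.
have gD : msupp g `<=` D by exact: fsubsetUr.
have hD : msupp (c *: f + g) `<=` D.
  apply: fsubset_trans (msuppD_le _ _) _.
  by rewrite fsetSU // msuppZ_le.
rewrite (linextEw _ fD) (linextEw _ gD) (linextEw _ hD) scaler_sumr -big_split /=.
by apply: eq_bigr => m _; rewrite mcoeffD mcoeffZ scalerDl scalerA.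
Qed.

HB.instance Definition _ phi :=
  GRing.isLinear.Build K (Lam K) (Lam K) *:%R (linext phi) (linext_linear phi).
HB.instance Definition _ i := GRing.Linear.copy (@xmul K i) (linext _).
HB.instance Definition _ i := GRing.Linear.copy (@dpart K i) (linext _).

Lemma malgUZ (c : K) m : << c *g m >> = c *: << m >> :> Lam K.
Proof. by apply/malgP => m'; rewrite mcoeffZ !mcoeffU mulrnAr mulr1. Qed.

Lemma linextU phi m : linext phi << m >> = phi m.
Proof.
by rewrite (linextEw phi (@msuppU_le _ _ m 1)) big_seq_fset1 mcoeffUU scale1r.
Qed.

Lemma linear_basis_ext (A B : {linear Lam K -> Lam K}) :
  (forall m, A << m >> = B << m >>) -> A =1 B.
Proof.
move=> AB f; rewrite (monalgE f) !linear_sum /=.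
by apply: eq_bigr => m _; rewrite malgUZ !linearZ AB.
Qed.

Lemma xmulU i m :
  xmul i << m >> = if i \in m then 0 else gsign K i m *: << i |` m >>.
Proof. by rewrite /xmul linextU -malgUZ. Qed.

Lemma dpartU i m :
  dpart i << m >> = if i \in m then gsign K i m *: << m `\ i >> else 0.
Proof. by rewrite /dpart linextU -malgUZ. Qed.

Lemma xmul_sum i n (F : 'I_n -> Lam K) :
  xmul i (\sum_(k < n) F k) = \sum_(k < n) xmul i (F k).
Proof. exact: (linear_sum (@xmul K i)). Qed.

Lemma xmul_xmul i f : xmul i (xmul i f) = 0.
Proof.
apply: (linear_basis_ext (A := xmul i \o @xmul K i) (B := \0)) => m.
exact: (basis_X_X (X := fun i => @xmul K i) xmulU).
Qed.

Lemma xmulC i j f : xmul i (xmul j f) = - xmul j (xmul i f).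
Proof.
apply: (linear_basis_ext (A := xmul i \o @xmul K j)
  (B := \- (xmul j \o @xmul K i))) => m.
exact: (basis_XC (X := fun i => @xmul K i) xmulU).
Qed.

Lemma dpart_dpart i f : dpart i (dpart i f) = 0.
Proof.
apply: (linear_basis_ext (A := dpart i \o @dpart K i) (B := \0)) => m.
exact: (basis_D_D (D := fun i => @dpart K i) dpartU).
Qed.

Lemma dpartC i j f : dpart i (dpart j f) = - dpart j (dpart i f).
Proof.
apply: (linear_basis_ext (A := dpart i \o @dpart K j)
  (B := \- (dpart j \o @dpart K i))) => m.
exact: (basis_DC (D := fun i => @dpart K i) dpartU).
Qed.

Lemma dpart_xmul i f : dpart i (xmul i f) = f - xmul i (dpart i f).
Proof.
apply: (linear_basis_ext (A := dpart i \o @xmul K i)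
  (B := idfun \- (xmul i \o @dpart K i))) => m.
exact: (basis_D_X (X := fun i => @xmul K i) (D := fun i => @dpart K i) xmulU dpartU).
Qed.

Lemma dpart_xmul_neq i j f : i != j -> dpart i (xmul j f) = - xmul j (dpart i f).
Proof.
move=> ij; apply: (linear_basis_ext (A := dpart i \o @xmul K j)
  (B := \- (xmul j \o @dpart K i))) => m.
exact: (basis_D_X_neq (X := fun i => @xmul K i) (D := fun i => @dpart K i) xmulU dpartU).
Qed.

Lemma xprod_linear i k : linear (@xprod K i k).
Proof. by elim: k => [|k IH] c f g //=; rewrite !linearP IH. Qed.

HB.instance Definition _ i k :=
  GRing.isLinear.Build K (Lam K) (Lam K) *:%R (@xprod K i k) (@xprod_linear i k).

Lemma xprodSr i k f :
  xprod i k.+1 f = xprod i k (xmul (i + 3 * k) (xmul (i + 3 * k + 1) f)).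
Proof. exact: erefl. Qed.

(** The definition peels off the pair of highest index; the recursion for v_i needs the lowest pair
    in front. *)
Lemma xprodSl i k f :
  xprod i k.+1 f = xmul i (xmul i.+1 (xprod (i + 3) k f)).
Proof.
elim: k f => [|k IH] f; first by rewrite xprodSr muln0 addn0 addn1.
by rewrite xprodSr IH [in RHS]xprodSr mulnS addnA.
Qed.

Lemma dpart_idx_bound i f : (idx_bound f <= i)%N -> dpart i f = 0.
Proof.
move=> le_fi; rewrite /dpart /linext big1_seq // => m /= fm.
case: ifP => im; last by rewrite scaler0.
suff : (i < idx_bound f)%N by rewrite ltnNge le_fi.
apply: (@bigmaxn_sup_seq _ (enum_fset (msupp f)) m) => //.
exact: (@bigmaxn_sup_seq _ (enum_fset m) i).
Qed.

(** Terms past the bound vanish, so a single N can serve several arguments at once. *)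
Lemma pivotEw i f N : (idx_bound f <= N)%N ->
  pivot i f = \sum_(k < N) xprod i k (dpart (i + 3 * k) f).
Proof.
move=> leN; rewrite /pivot.
rewrite -!(big_mkord xpredT (fun k => xprod i k (dpart (i + 3 * k) f))).
rewrite (big_cat_nat _ leN) //= [X in _ + X]big_nat_cond [X in _ + X]big1 ?addr0 //.
move=> k /andP[/andP[lek _] _]; rewrite dpart_idx_bound ?linear0 //; lia.
Qed.

Lemma pivot_linear i : linear (@pivot K i).
Proof.
move=> c f g; pose N := maxn (idx_bound (c *: f + g)) (maxn (idx_bound f) (idx_bound g)).
rewrite !(@pivotEw i _ N); try (rewrite /N; lia).
rewrite scaler_sumr -big_split /=; apply: eq_bigr => k _.
by rewrite !linearP.
Qed.

HB.instance Definition _ i :=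
  GRing.isLinear.Build K (Lam K) (Lam K) *:%R (@pivot K i) (pivot_linear i).

Lemma pivotE i f :
  pivot i f = dpart i f + xmul i (xmul i.+1 (pivot i.+3 f)).
Proof.
(* One term is added to the sum: once k = 0 is split off, exactly the [idx_bound f] terms of the sum
   for v_(i+3) remain. *)
rewrite (@pivotEw i f (idx_bound f).+1) // big_ord_recl muln0 addn0; congr (_ + _).
rewrite /pivot !xmul_sum.
by apply: eq_bigr => k _; rewrite lift0 xprodSl mulnS addnA !addn3.
Qed.

(** Each term of v_i is a product of 2k factors x_j and one d_j, all with j >= i; passing A through
    this odd number of factors gives one sign. *)
Lemma pivot_anticomm (A : {linear Lam K -> Lam K}) i :
    (forall j f, (i <= j)%N -> dpart j (A f) = - A (dpart j f)) ->
    (forall j f, (i <= j)%N -> xmul j (A f) = - A (xmul j f)) ->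
  forall f, pivot i (A f) = - A (pivot i f).
Proof.
move=> Ad Ax f; pose N := maxn (idx_bound f) (idx_bound (A f)).
have Axp k g : xprod i k (A g) = A (xprod i k g).
  elim: k g => // k IH g; rewrite !xprodSr Ax; last by lia.
  rewrite (linearN (@xmul K _)) /= Ax; last by lia.
  by rewrite opprK IH.
rewrite !(@pivotEw i _ N); try (rewrite /N; lia).
rewrite (linear_sum A) -sumrN; apply: eq_bigr => k _.
rewrite Ad; last by lia.
by rewrite (linearN (@xprod K i k)) /= Axp.
Qed.

Lemma pivot_xmul i j f : (j < i)%N -> pivot i (xmul j f) = - xmul j (pivot i f).
Proof.
move=> ji; apply: (pivot_anticomm (A := @xmul K j)) => k g ik.
  by rewrite dpart_xmul_neq //; lia.
exact: xmulC.
Qed.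

Lemma pivot_dpart i j f : (j < i)%N -> pivot i (dpart j f) = - dpart j (pivot i f).
Proof.
move=> ji; apply: (pivot_anticomm (A := @dpart K j)) => k g ik.
  exact: dpartC.
by rewrite /= dpart_xmul_neq ?opprK //; lia.
Qed.

Lemma pivot_systemP :
  pivot_system (fun i => @xmul K i) (fun i => @dpart K i) (fun i => @pivot K i).
Proof.
split=> *; first exact: xmul_xmul.
- exact: xmulC.
- exact: dpart_dpart.
- exact: dpart_xmul.
- exact: dpart_xmul_neq.
- exact: pivotE.
- exact: pivot_xmul.
- exact: pivot_dpart.
Qed.

End Operators.

(** * Weights *)

Section Weights.
Implicit Types (u : nat -> int) (a b : pred nat) (w : seq nat) (l : nat).

(* A multidegree in Z^3 is represented by its images under all integer
   functionals; one that sends wt v_i to u i is exactly a solution u of this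
   recurrence. *)
Definition pivot_rec u := forall i, u i.+3 = 2 * u i + u i.+1.

(** The solution of [pivot_rec] with initial values x, y, z. *)
Fixpoint wseq (x y z : int) (i : nat) : int :=
  if i is i'.+1 then wseq y z (2 * x + y) i' else x.

Lemma wseq_rec x y z : pivot_rec (wseq x y z).
Proof.
move=> i; elim: i x y z => [|i IH] x y z //.
by rewrite -[LHS]/(wseq y z (2 * x + y) i.+3) IH.
Qed.

Lemma wseq_lin x y z i :
  wseq x y z i = x * wseq 1 0 0 i + y * wseq 0 1 0 i + z * wseq 0 0 1 i.
Proof.
elim: i x y z => [|i IH] x y z /=; first by ring.
by rewrite (IH y) (IH 0 0 (2 * 1 + 0)) (IH 1 0 (2 * 0 + 1)) (IH 0 1 (2 * 0 + 0)); ring.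
Qed.

Definition weight u w l : int := u l - \sum_(j <- w) u j.

(* (w, l) stands for the monomial x_w v_l. Excluding the factor
   x_(l-3) x_(l-2) is needed for uniqueness: x_(l-3) x_(l-2) v_l has the same
   weight as v_(l-3). *)
Definition good w l :=
  [/\ uniq w, forall j, j \in w -> (j.+1 < l)%N &
      forall j, j \in w -> j.+1 \in w -> j.+3 != l].

(* The weight of a good monomial is, in effect, an expansion in powers of
   the root t of t^3 - t - 2, with digits 0 and 1; as t has norm 2, the parity
   of the constant coefficient recovers the last digit. *)
Definition dval u b l : int := u l - \sum_(j < l) (b j)%:R * u j.

Definition dgood b l :=
  (forall j, b j -> (j.+1 < l)%N) /\ (forall j, b j -> b j.+1 -> j.+3 != l).

Lemma dgoodS b l : dgood b l.+1 -> dgood (fun j => b j.+1) l.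
Proof. by move=> [b1 b2]; split=> j => [/b1|/b2 /[apply]]; lia. Qed.

(* Twice the sequence u moved one step back: the factor 2 keeps it integral. *)
Definition wunshift u i : int := if i is i'.+1 then 2 * u i' else u 2%N - u 0%N.

Lemma wunshift_rec u : pivot_rec u -> pivot_rec (wunshift u).
Proof. by move=> uP [|i] /=; rewrite ?uP; ring. Qed.

(** Strips the lowest digit: [wunshift] is multiplication by 2/t, and 2/t = t^2 - 1 because t^3 - t
    = 2. *)
Lemma dval_wunshift u b l :
  dval (wunshift u) b l.+1 =
  2 * dval u (fun j => b j.+1) l - (b 0%N)%:R * (u 2%N - u 0%N).
Proof.
rewrite /dval big_ord_recl /=; set s := (X in _ - (_ + X)).
have -> : s = \sum_(i < l) 2 * ((b i.+1)%:R * u i).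
  by apply: eq_bigr => i _; ring.
by rewrite -mulr_sumr; ring.
Qed.

Lemma dval_parity b l :
  exists z, dval (wseq 1 0 0) b l.+1 = 2 * z - (b 0%N)%:R.
Proof.
have even i : exists z, wseq 1 0 0 i.+1 = 2 * z.
  (* Shifted by one, [wseq 1 0 0] has initial values 0, 0, 2. *)
  by exists (wseq 0 0 1 i); rewrite /= wseq_lin; ring.
rewrite /dval big_ord_recl mulr1.
have [z1 ->] := even l.
have [z2 ->] : exists z,
    \sum_(i < l) (b (lift ord0 i))%:R * wseq 1 0 0 (lift ord0 i) = 2 * z.
  elim/big_ind: _ => [|x y [z ->] [t ->]|i _]; first by exists 0.
    by exists (z + t); ring.
  by have [z ->] := even i; exists ((b (lift ord0 i))%:R * z); ring.
by exists (z1 - z2); ring.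
Qed.

Lemma dval_eq_digit a b l l' :
    dval (wseq 1 0 0) a l.+1 = dval (wseq 1 0 0) b l'.+1 -> a 0%N = b 0%N.
Proof.
have [z ->] := dval_parity a l; have [t ->] := dval_parity b l'.
by case: (a 0%N); case: (b 0%N) => //=; lia.
Qed.

(** Expanding t^0 forces the digits 1, 1, 0, with successive quotients t^2 - 1, t and 1. So t^0 is
    the target again, with three digits fewer. This mirrors v_0 and x_0 x_1 v_3 having equal weight;
    the descent ends at the excluded top pair or at a length below 3. *)
Lemma dval_neq_w0 b l : dgood b l.+1 ->
  ~ (forall u, pivot_rec u -> dval u b l.+1 = u 0%N).
Proof.
elim/ltn_ind: l b => l IH b bg bE.
have e0 := wseq_rec 1 0 0.
case: l IH bg bE => [|[|l]] IH [b1 b2] bE.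
- have := bE _ e0; rewrite /dval big_ord_recl big_ord0 /=.
  have [/b1//|_] := boolP (b 0%N); lia.
- have := bE _ e0; rewrite /dval !big_ord_recl big_ord0 /=.
  by have [/b1//|_] := boolP (b 1%N); case: (b 0%N) => /=; lia.
have b0 : b 0%N.
  have := bE _ e0; have [z ->] := dval_parity b l.+2.
  by case: (b 0%N) => //=; lia.
have bE1 u : pivot_rec u -> dval u (fun j => b j.+1) l.+2 = u 2%N - u 0%N.
  move=> uP; have := bE _ (wunshift_rec uP).
  by rewrite dval_wunshift b0 /=; lia.
have b1' : b 1%N.
  have := bE1 _ e0; have [z ->] := dval_parity (fun j => b j.+1) l.+1.
  by case: (b 1%N) => //=; lia.
have bE2 u : pivot_rec u -> dval u (fun j => b j.+2) l.+1 = u 1%N.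
  move=> uP; have := bE1 _ (wunshift_rec uP).
  by rewrite dval_wunshift b1' /=; lia.
have b2' : b 2%N = false.
  have := bE2 _ e0; have [z ->] := dval_parity (fun j => b j.+2) l.
  by case: (b 2%N) => //=; lia.
have bE3 u : pivot_rec u -> dval u (fun j => b j.+3) l = u 0%N.
  move=> uP; have := bE2 _ (wunshift_rec uP).
  by rewrite dval_wunshift b2' /=; lia.
(* When the length was exactly 3, the digits at 0 and 1 form the excluded top pair. *)
case: l IH b1 b2 {bE bE1 bE2} bE3 => [|l] IH b1 b2 bE3.
  by have := b2 _ b0 b1'.
apply: (IH l _ _ _ bE3); first by lia.
exact: (dgoodS (dgoodS (dgoodS (conj b1 b2)))).
Qed.

Lemma dval_inj a b l l' : dgood a l -> dgood b l' ->
    (forall u, pivot_rec u -> dval u a l = dval u b l') ->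
  l = l' /\ a =1 b.
Proof.
elim: l l' a b => [|l IH] [|l'] a b ag bg E.
- by split=> // j; apply/idP/idP => [/(ag.1)|/(bg.1)].
(* An expansion of length 0 has no digits and the value t^0. *)
- case: (dval_neq_w0 bg) => u uP; rewrite -E //.
  by rewrite /dval big_ord0 subr0.
- case: (dval_neq_w0 ag) => u uP; rewrite E //.
  by rewrite /dval big_ord0 subr0.
have ab0 := dval_eq_digit (E _ (wseq_rec 1 0 0)).
have [|-> ab] := IH l' _ _ (dgoodS ag) (dgoodS bg).
  by move=> u uP; have := E _ (wunshift_rec uP); rewrite !dval_wunshift ab0; lia.
by split=> // -[|j]; [|exact: ab].
Qed.

Lemma weight_dval u w l : good w l -> weight u w l = dval u (mem w) l.
Proof.
move=> [w_uniq w_lt _]; congr (_ - _).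
have w_perm : perm_eq w [seq j <- index_iota 0 l | j \in w].
  apply: uniq_perm; rewrite ?filter_uniq ?iota_uniq // => j.
  rewrite mem_filter mem_index_iota /=; case: (boolP (j \in w)) => //= /w_lt.
  lia.
rewrite (perm_big _ w_perm) big_filter big_mkcond big_mkord; apply: eq_bigr => j _.
by rewrite /=; case: ifP => _; rewrite ?mul1r ?mul0r.
Qed.

Lemma weight_inj w w' l l' : good w l -> good w' l' ->
    (forall u, pivot_rec u -> weight u w l = weight u w' l') ->
  l = l' /\ perm_eq w w'.
Proof.
move=> wg w'g E.
have [|||-> ww'] := @dval_inj (mem w) (mem w') l l'.
- by split; case: wg.
- by split; case: w'g.
- by move=> u uP; rewrite -!weight_dval // E.
split=> //; apply: uniq_perm; [by case: wg|by case: w'g|exact: ww'].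
Qed.

Lemma wseq_odd (i : nat) (p q r : int) :
  exists z, wseq (2 * p + 1) (2 * q + 1) (2 * r + 1) i = 2 * z + 1.
Proof.
elim: i p q r => [|i IH] p q r; first by exists p.
have [z zE] := IH q r (2 * p + q + 1); exists z; rewrite -zE /=.
by congr wseq; ring.
Qed.

(* Specialising all three generators to weight 1 counts total degree, which is
   odd for every pivot element. *)
Lemma weight_parity w l :
  exists z, weight (wseq 1 1 1) w l = 2 * z + (~~ odd (size w))%:Z.
Proof.
have odd1 i : exists z, wseq 1 1 1 i = 2 * z + 1.
  exact: (wseq_odd i 0 0 0).
rewrite /weight; have [z ->] := odd1 l.
have [t ->] : exists t, \sum_(j <- w) wseq 1 1 1 j = 2 * t + (odd (size w))%:Z.
  elim: w => [|j w [t IH]]; first by exists 0; rewrite big_nil.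
  have [z1 E] := odd1 j; rewrite big_cons IH E /=.
  by case: (odd _) => /=; [exists (z1 + t + 1)|exists (z1 + t)]; ring.
by exists (z - t); case: (odd _) => /=; ring.
Qed.

End Weights.

(** * Brackets of monomials *)

Section PivotAlgebra.
Variables (K : fieldType) (V : lmodType K) (x d v : nat -> {linear V -> V}).
Hypothesis xdvP : pivot_system x d v.
Implicit Types (f : V) (w : seq nat).

Let xx := ps_xx xdvP.
Let xC := ps_xC xdvP.
Let dd := ps_dd xdvP.
Let dx := ps_dx xdvP.
Let dx_neq := ps_dx_neq xdvP.
Let vE := ps_vE xdvP.
Let vx := ps_vx xdvP.
Let vd := ps_vd xdvP.

(** The part of v_n beyond d_n carries the factor x_n, so on multiples of x_n only d_n acts. *)
Lemma v_x_diag n f : v n (x n f) = f - x n (d n f).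
Proof.
by rewrite vE dx vx ?linearN /= 1?xC ?xx ?linear0 ?oppr0 ?addr0 //; lia.
Qed.

Lemma x_v_v n m f : (n < m)%N ->
  x n (v m (v n f)) = - x n (d n (v m f)).
Proof.
move=> nm; rewrite (vE n f) linearD /= vd // vx //.
by rewrite linearD !linearN /= xx oppr0 addr0.
Qed.

(** Both d_n and x_n x_(n+1) v_(n+3) square to zero; in the cross terms d_n x_n + x_n d_n = 1 leaves
    x_(n+1) v_(n+3). *)
Lemma v_sqr n f : v n (v n f) = x n.+1 (v n.+3 f).
Proof.
rewrite (vE n f) linearD /= v_x_diag (vE n (d _ _)) dd add0r.
rewrite vd ?dx_neq; try lia.
by rewrite !linearN /= opprK addrC addrK.
Qed.

Lemma v_vS n f :
  v n (v n.+1 f) + v n.+1 (v n f) = - x n (v n.+3 f).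
Proof.
rewrite (vE n (v _ _)) (vE n f) x_v_v; last by lia.
rewrite linearD /= vd // vx // v_x_diag.
rewrite linearB linearN /= opprB addrACA subrr add0r addrA addrC.
by rewrite addNr addr0.
Qed.

Definition xw w f := foldr (fun i => x i) f w.

Lemma xw_linear w : linear (xw w).
Proof. by elim: w => [|i w IH] c f g //=; rewrite IH linearP. Qed.

HB.instance Definition _ w := GRing.isLinear.Build K V V *:%R (xw w) (xw_linear w).

Lemma xw_cat w1 w2 f : xw (w1 ++ w2) f = xw w1 (xw w2 f).
Proof. by rewrite /xw foldr_cat. Qed.

Lemma signN (k : nat) f : - ((-1) ^+ k *: f) = (-1) ^+ k.+1 *: f.
Proof. by rewrite exprS mulN1r scaleNr. Qed.

Lemma sign_signr (k : nat) f : (-1) ^+ k *: ((-1) ^+ k *: f) = f.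
Proof. by rewrite scalerA -expr2 sqrr_sign scale1r. Qed.

Lemma x_xw i w f : x i (xw w f) = (-1) ^+ size w *: xw w (x i f).
Proof.
elim: w => [|j w IH] /=; first by rewrite scale1r.
by rewrite xC IH linearZ signN.
Qed.

Lemma xw_x i w f : xw w (x i f) = (-1) ^+ size w *: x i (xw w f).
Proof. by rewrite x_xw sign_signr. Qed.

Lemma x_xw0 i w f : i \in w -> x i (xw w f) = 0.
Proof.
elim: w => [//|j w IH] /=; rewrite inE; have [-> _|_ /= iw] := eqVneq i j.
  exact: xx.
by rewrite xC IH // linear0 oppr0.
Qed.

Lemma xw_nuniq w f : ~~ uniq w -> xw w f = 0.
Proof.
elim: w => [//|j w IH] /=; rewrite negb_and negbK => /orP[jw|w_nuniq].
  exact: x_xw0.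
by rewrite IH // linear0.
Qed.

Lemma xw_perm w1 w2 : perm_eq w1 w2 ->
  exists c : K, forall f, xw w1 f = c *: xw w2 f.
Proof.
elim: w1 w2 => [|i w1 IH] w2.
  by move/perm_size; case: w2 => // _; exists 1 => f; rewrite scale1r.
move=> w12; have iw2 : i \in w2 by rewrite -(perm_mem w12) mem_head.
case/splitPr: iw2 w12 => p1 p2 w12.
have [|c cE] := IH (p1 ++ p2).
  by rewrite -(perm_cons i) (perm_trans w12) // perm_catC /= perm_cons perm_catC.
exists (c * (-1) ^+ size p1) => f.
by rewrite /= cE !xw_cat /= xw_x linearZ scalerA -mulrA -expr2 sqrr_sign mulr1.
Qed.

Lemma v_xw n w f : (forall j, j \in w -> (j < n)%N) ->
  v n (xw w f) = (-1) ^+ size w *: xw w (v n f).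
Proof.
elim: w => [|j w IH] wn /=; first by rewrite scale1r.
rewrite vx ?wn ?mem_head // IH; last by move=> k kw; rewrite wn // inE kw orbT.
by rewrite (linearZZ (x j)) /= signN.
Qed.

Lemma xw_xw w1 w2 f :
  xw w1 (xw w2 f) = (-1) ^+ (size w1 * size w2) *: xw w2 (xw w1 f).
Proof.
elim: w1 => [|i w1 IH] /=; first by rewrite scale1r.
by rewrite IH linearZ /= x_xw scalerA -exprD mulSn addnC.
Qed.

Lemma d_xw_notin n w f : n \notin w ->
  d n (xw w f) = (-1) ^+ size w *: xw w (d n f).
Proof.
elim: w => [|j w IH] /=; first by rewrite scale1r.
by rewrite inE negb_or => /andP[nj nw]; rewrite dx_neq // IH // (linearZZ (x j)) /= signN.
Qed.

Lemma d_xw_in n w : n \in w -> uniq w -> exists c : K, forall f,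
  d n (xw w f) = c *: xw (rem n w) f + (-1) ^+ size w *: xw w (d n f).
Proof.
elim: w => [//|j w IH] /=; rewrite inE; have [<- _|nj /= nw] := eqVneq n j.
  case/andP=> nw _; exists 1 => f.
  by rewrite dx d_xw_notin // (linearZZ (x n)) /= signN scale1r.
case/andP=> _ w_uniq; have [c cE] := IH nw w_uniq; exists (- c) => f.
by rewrite dx_neq // cE linearD !(linearZZ (x j)) /= opprD signN scaleNr.
Qed.

(** All indices in w lie below n, so v_n passes through x_w and only the bracket of v_n with v_m
    remains. *)
Lemma v_v_base n m w f : (m <= n.+1)%N ->
    (forall j, j \in w -> (j.+1 < m)%N) ->
  v n (xw w (v m f)) + (-1) ^+ size w *: xw w (v m (v n f)) =
  (-1) ^+ size w *: xw w (v n (v m f) + v m (v n f)).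
Proof.
move=> mn wm; rewrite linearD scalerDr v_xw // => j /wm; lia.
Qed.

(** Since n and n+1 lie below m, v_m anticommutes with d_n and commutes with x_n x_(n+1); the
    recursion for v_n then splits the bracket. *)
Lemma v_v_step n m w f : (n.+2 <= m)%N ->
  v n (xw w (v m f)) + (-1) ^+ size w *: xw w (v m (v n f)) =
  (d n (xw w (v m f)) - (-1) ^+ size w *: xw w (d n (v m f))) +
  x n (x n.+1 (v n.+3 (xw w (v m f)) + (-1) ^+ size w *: xw w (v m (v n.+3 f)))).
Proof.
move=> nm.
have dE : v m (d n f) = - d n (v m f) by rewrite vd //; lia.
have xE g : v m (x n (x n.+1 g)) = x n (x n.+1 (v m g)).
  rewrite vx; last by lia.
  by rewrite vx; [rewrite (linearN (x n)) opprK | lia].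
have xwE g : xw w (x n (x n.+1 g)) = x n (x n.+1 (xw w g)).
  by rewrite !xw_x (linearZZ (x n)) /= sign_signr.
rewrite (vE n (xw _ _)) (vE n f) (linearD (v m)) /= dE xE.
rewrite (linearD (xw w)) /= xwE (linearN (xw w)) /= scalerDr scalerN addrACA.
by congr (_ + _); rewrite (linearD (x n.+1)) (linearD (x n)) !linearZZ.
Qed.

Definition weight_shift n w m w' l :=
  forall u, pivot_rec u -> weight u w' l = u n + weight u w m.

(* The supercommutator [v_n, x_w v_m], where x_w v_m has parity |w| + 1. *)
Definition v_bracket n w m f :=
  v n (xw w (v m f)) + (-1) ^+ size w *: xw w (v m (v n f)).

(* Iterating v_n = d_n + x_n x_(n+1) v_(n+3), at each step at most one of the
   two summands contributes, according to whether x_n divides the monomial. *)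
Lemma v_bracket_mono n m w : (n <= m.+1)%N -> good w m ->
  v_bracket n w m =1 \0 \/ exists (c : K) w' l,
    [/\ good w' l, (n.+2 <= l)%N, forall j, j \in w -> (j < n)%N -> j \in w',
        weight_shift n w m w' l & forall f, v_bracket n w m f = c *: xw w' (v l f)].
Proof.
(* The recursion replaces n by n + 3 and can overshoot m by one, whence the bound n <= m + 1. *)
have [k] := ubnP (m.+1 - n); elim: k n => [|k IH] n // lek nm wg.
have [w_uniq w_lt w_top] := wg.
have [mn|mn] := leqP m n.+1.
  have base (c : K) i l : (m <= i.+1)%N -> (i.+1 < l)%N -> (m.+2 <= l)%N ->
      (n.+2 <= l)%N -> (forall u, pivot_rec u -> u l = u i + u n + u m) ->
      (forall f, v n (v m f) + v m (v n f) = c *: x i (v l f)) ->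
      exists (c : K) w' l, [/\ good w' l, (n.+2 <= l)%N,
        forall j, j \in w -> (j < n)%N -> j \in w', weight_shift n w m w' l &
        forall f, v_bracket n w m f = c *: xw w' (v l f)].
    move=> mi il ml nl uE vE'.
    exists ((-1) ^+ size w * c), (w ++ [:: i]), l; split=> //.
    - split=> [|j|j].
      + by rewrite cat_uniq w_uniq /= orbF andbT; apply/negP => /w_lt; lia.
      + by rewrite mem_cat inE => /orP[/w_lt|/eqP->]; lia.
      + by rewrite !mem_cat !inE => /orP[/w_lt ?|/eqP->] /orP[/w_lt|/eqP]; lia.
    - by move=> j jw _; rewrite mem_cat jw.
    - by move=> u uP; rewrite /weight big_cat big_seq1 /= uE //; ring.
    - by move=> f; rewrite /v_bracket v_v_base // vE' linearZZ scalerA xw_cat.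
  right; have [mE|[mE|mE]] : m.+1 = n \/ m = n \/ m = n.+1 by lia.
  - apply: (base (-1) m m.+3); try lia; first by move=> u ->; rewrite -mE; ring.
    by move=> f; rewrite -mE addrC v_vS scaleN1r.
  - apply: (base 2 n.+1 n.+3); try lia; first by move=> u ->; rewrite mE; ring.
    by move=> f; rewrite mE v_sqr -mulr2n scaler_nat.
  - apply: (base (-1) n n.+3); try lia; first by move=> u ->; rewrite mE; ring.
    by move=> f; rewrite mE v_vS scaleN1r.
have nm2 : (n.+2 <= m)%N by lia.
have {}IH := IH n.+3 ltac:(lia) ltac:(lia) wg.
have [nw|nw] := boolP (n \in w).
  (* Indices of w below n + 3 survive in the bracket with v_(n+3), so x_n occurs twice. *)
  have x0 f : x n (x n.+1 (v_bracket n.+3 w m f)) = 0.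
    case: IH => [->|[c [w' [l [_ _ ww' _ ->]]]]]; first by rewrite !linear0.
    by rewrite !linearZ /= xC x_xw0 ?linear0 ?oppr0 ?scaler0 // ww' //; lia.
  have [c cE] := d_xw_in nw w_uniq.
  right; exists c, (rem n w), m; split=> //.
  - split; first exact: rem_uniq.
      by move=> j /mem_rem; exact: w_lt.
    by move=> j /mem_rem jw /mem_rem; exact: w_top.
  - by move=> j jw jn; rewrite mem_rem_uniq // inE jw andbT; apply/eqP; lia.
  - move=> u uP; rewrite /weight [in RHS](perm_big _ (perm_to_rem nw)) /= big_cons.
    ring.
  - by move=> f; rewrite /v_bracket v_v_step // x0 addr0 cE addrK.
have d0 f : d n (xw w (v m f)) - (-1) ^+ size w *: xw w (d n (v m f)) = 0.
  by rewrite d_xw_notin // subrr.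
case: IH => [b0|[c [w' [l [[w'_uniq w'_lt w'_top] nl ww' wtE bE]]]]].
  left=> f; rewrite /v_bracket v_v_step // d0 add0r.
  by rewrite -[X in x _ (x _ X)]/(v_bracket n.+3 w m f) b0 !linear0.
have vbE f : v_bracket n w m f = c *: xw [:: n, n.+1 & w'] (v l f).
  rewrite /v_bracket v_v_step // d0 add0r.
  by rewrite -[X in x _ (x _ X)]/(v_bracket n.+3 w m f) bE !linearZ.
have [nw'|] := boolP (uniq [:: n, n.+1 & w']); last first.
  by move=> nuniq; left=> f; rewrite vbE xw_nuniq // scaler0.
right; exists c, [:: n, n.+1 & w'], l; split=> //.
(* Induction gives n + 5 <= l, which keeps n and n + 1 clear of the excluded pair l - 3, l - 2. *)
- split=> // j; first by rewrite !inE => /or3P[/eqP->|/eqP->|/w'_lt]; lia.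
  rewrite !inE => /or3P[/eqP->|/eqP->|jw'] /or3P[/eqP|/eqP|j1w']; try lia.
  exact: w'_top.
- lia.
- by move=> j jw jn; rewrite !inE ww' ?orbT //; lia.
- move=> u uP; transitivity (weight u w' l - u n - u n.+1).
    by rewrite /weight !big_cons; ring.
  by rewrite wtE // uP; ring.
Qed.

(** * Supercommutators and squares of monomials *)

Definition monop (w : seq nat) l f := xw w (v l f).

(** The sign is that of the supercommutator, as x_r v_n is odd exactly when r has even length. *)
Definition monop_br r n w m f :=
  monop r n (monop w m f)
    - (-1) ^+ (~~ odd (size r) && ~~ odd (size w)) *: monop w m (monop r n f).

Lemma monop_brC r n w m f :
  monop_br r n w m f =
  - (-1) ^+ (~~ odd (size r) && ~~ odd (size w)) *: monop_br w m r n f.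
Proof.
rewrite /monop_br scalerBr [in RHS]andbC !scalerA mulNr -expr2 sqrr_sign.
by rewrite scaleN1r scaleNr opprK addrC andbC.
Qed.

(** The indices in r lie below m, so v_m passes through x_r and x_r factors out of the bracket. *)
Lemma monop_brE n m r w f : (n <= m)%N -> good r n ->
  monop_br r n w m f = xw r (v_bracket n w m f).
Proof.
move=> nm [_ r_lt _]; rewrite /monop_br /monop /v_bracket linearD /=; congr (_ + _).
rewrite v_xw; last by move=> j /r_lt; lia.
rewrite (linearZZ (xw w)) (linearZZ (xw r)) /= (xw_xw w r) !scalerA -scaleNr.
congr (_ *: _).
rewrite -(signr_odd _ (_ * _)%N) oddM -(signr_odd _ (size r)) -(signr_odd _ (size w)).
by case: (odd (size r)); case: (odd (size w)); rewrite /= ?expr0 ?expr1; ring.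
Qed.

(** The zero operator is a separate case, since there may be no good monomial of weight [delta]. *)
Definition is_mono (A : V -> V) (delta : (nat -> int) -> int) :=
  A =1 (fun=> 0) \/ exists (c : K) w l, [/\ good w l,
    forall u, pivot_rec u -> weight u w l = delta u &
    forall f, A f = c *: monop w l f].

Lemma eq_is_mono A A' delta delta' : A =1 A' ->
    (forall u, pivot_rec u -> delta u = delta' u) ->
  is_mono A delta -> is_mono A' delta'.
Proof.
move=> AA' dd' [A0|[c [w [l [wg wE AE]]]]]; first by left=> f; rewrite -AA' A0.
by right; exists c, w, l; split=> // [u uP|f]; rewrite -?AA' // wE // dd'.
Qed.

Lemma is_mono0 A delta : is_mono A delta -> A 0 = 0.
Proof.
by move=> [->//|[c [w [l [_ _ ->]]]]]; rewrite /monop !linear0.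
Qed.

Lemma is_monoZ A delta (c : K) : is_mono A delta ->
  is_mono (fun f => c *: A f) delta.
Proof.
move=> [A0|[b [w [l [wg wE AE]]]]]; first by left=> f; rewrite A0 scaler0.
by right; exists (c * b), w, l; split=> // f; rewrite AE scalerA.
Qed.

Lemma is_mono_gen i : is_mono (v i) (fun u => u i).
Proof.
right; exists 1, [::], i; split=> // [u _|f].
  by rewrite /weight big_nil subr0.
by rewrite scale1r.
Qed.

Lemma monop_br_mono n m r w : good r n -> good w m ->
  is_mono (monop_br r n w m) (fun u => weight u r n + weight u w m).
Proof.
wlog nm : n m r w / (n <= m)%N => [IH rg wg|rg wg].
  have [nm|/ltnW mn] := leqP n m; first exact: IH.
  apply: eq_is_mono (is_monoZ _ (IH _ _ _ _ mn wg rg)) => [f|u _].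
    by rewrite [RHS]monop_brC.
  by rewrite addrC.
have [_ r_lt _] := rg.
case: (@v_bracket_mono n m w) => // [|b0|[c [w' [l [[_ w'_lt w'_top] nl _ wtE bE]]]]].
- lia.
- by left=> f; rewrite monop_brE // b0 linear0.
have BE f : monop_br r n w m f = c *: monop (r ++ w') l f.
  by rewrite monop_brE // bE linearZZ /= /monop xw_cat.
have [rw'_uniq|nuniq] := boolP (uniq (r ++ w')); last first.
  by left=> f; rewrite BE /monop xw_nuniq // scaler0.
right; exists c, (r ++ w'), l; split=> //.
(* Indices in r are at most n - 2 while l >= n + 2, so none belongs to the excluded pair. *)
- split=> // j; rewrite !mem_cat => /orP[/r_lt ?|jw']; try lia.
  + by have := w'_lt _ jw'; lia.
  + by case/orP=> [/r_lt|/(w'_top _ jw')]; lia.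
- move=> u uP; transitivity (weight u w' l - \sum_(j <- r) u j).
    by rewrite /weight big_cat /=; ring.
  by rewrite wtE // /weight; ring.
Qed.

Lemma is_mono_bracket A B dA dB (oA oB : bool) :
    (exists z, dA (wseq 1 1 1) = 2 * z + oA%:Z) ->
    (exists z, dB (wseq 1 1 1) = 2 * z + oB%:Z) ->
    is_mono A dA -> is_mono B dB ->
  is_mono (fun f => A (B f) - (-1) ^+ (oA && oB) *: B (A f))
    (fun u => dA u + dB u).
Proof.
move=> [zA oAE] [zB oBE] Am Bm; have [A0 B0] := (is_mono0 Am, is_mono0 Bm).
case: Am => [A_0|[a [r [n [rg rE AE]]]]].
  by left=> f; rewrite !A_0 B0 scaler0 subr0.
case: Bm => [B_0|[b [w [m [wg wE BE]]]]].
  by left=> f; rewrite !B_0 A0 scaler0 subr0.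
(* The prescribed parity and the parity of the monomial agree: both are the total degree modulo
   2. *)
have oddE s l (o : bool) delta z : weight (wseq 1 1 1) s l = delta ->
    delta = 2 * z + o%:Z -> o = ~~ odd (size s).
  have [t ->] := weight_parity s l => <-.
  by case: o; case: odd => //=; lia.
have -> := oddE _ _ _ _ _ (rE _ (wseq_rec 1 1 1)) oAE.
have -> := oddE _ _ _ _ _ (wE _ (wseq_rec 1 1 1)) oBE.
have monopZ s l c f : monop s l (c *: f) = c *: monop s l f.
  by rewrite /monop !linearZZ.
apply: eq_is_mono (is_monoZ (a * b) (monop_br_mono rg wg)) => [f|u uP].
  rewrite /monop_br !AE !BE !monopZ scalerBr !scalerA; congr (_ - _ *: _).
  by ring.
by rewrite rE // wE.
Qed.

(** If w is nonempty, the square of x_w v_l repeats a factor x_i and vanishes; otherwise it is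
    v_l^2, given by [v_sqr]. *)
Lemma is_mono_sqr A delta : is_mono A delta ->
  is_mono (fun f => A (A f)) (fun u => 2 * delta u).
Proof.
move=> Am; have A0 := is_mono0 Am.
case: Am => [A_0|[c [w [l [wg wE AE]]]]]; first by left=> f; rewrite A_0.
case: w wg wE AE => [|i w] wg wE AE; last first.
  have xwZ b g : xw (i :: w) (b *: g) = b *: xw (i :: w) g by exact: linearZZ.
  left=> f; rewrite !AE /monop (linearZZ (v l)) v_xw; last first.
    by case: wg => _ w_lt _ j /w_lt; lia.
  rewrite !xwZ -xw_cat xw_nuniq ?scaler0 //.
  by rewrite /= mem_cat mem_head orbT.
right; exists (c * c), [:: l.+1], l.+3; split.
- split=> // j; rewrite !inE => /eqP->; lia.
- by move=> u uP; rewrite -wE // /weight big_seq1 big_nil uP; ring.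
- by move=> f; rewrite !AE /monop /= !linearZZ v_sqr scalerA.
Qed.

(** By [weight_inj] a good monomial of weight [delta] is unique up to the order of its factors,
    which affects only the scalar; W is this monomial if it exists, and 0 otherwise. *)
Lemma is_mono_line delta :
  exists W : V -> V, forall A, is_mono A delta -> exists c : K, A =1 (fun f => c *: W f).
Proof.
have [[w0 [l0 [w0g w0E]]]|none] := classic (exists w l,
    good w l /\ forall u, pivot_rec u -> weight u w l = delta u).
  exists (monop w0 l0) => A [A0|[c [w [l [wg wE AE]]]]].
    by exists 0 => f; rewrite A0 scale0r.
  have [u uP|<- /xw_perm[b bE]] := weight_inj wg w0g.
    by rewrite wE // w0E.
  by exists (c * b) => f; rewrite AE /monop bE scalerA.
exists (fun=> 0) => A [A0|[c [w [l [wg wE AE]]]]].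
  by exists 0 => f; rewrite A0 scaler0.
by case: none; exists w, l.
Qed.

End PivotAlgebra.

(** * Lie monomials in the generators *)

Section LieMonomials.
Variable K : fieldType.
Implicit Types (e : lexpr) (u : nat -> int).

Definition ldeg e u : int := \sum_(i < 3) u i * (lcount i e)%:Z.

Lemma ldeg_parity e : exists z, ldeg e (wseq 1 1 1) = 2 * z + (lodd e)%:Z.
Proof.
exists (ltotal e)./2%:Z.
have -> : ldeg e (wseq 1 1 1) = (ltotal e)%:Z.
  by rewrite /ldeg /ltotal !big_ord_recl !big_ord0 /=; lia.
by rewrite /lodd -{1}(odd_double_half (ltotal e)) -muln2; lia.
Qed.

Lemma leval_is_mono e :
  is_mono (fun i => @xmul K i) (fun i => @pivot K i) (leval e) (ldeg e).
Proof.
elim: e => [i|a IHa b IHb|a IHa] /=.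
- apply: eq_is_mono (is_mono_gen _ _ i) => // u _.
  rewrite /ldeg (bigD1 i) //= eqxx mulr1 big1 ?addr0 // => j ji.
  by rewrite (negPf ji) mulr0.
- have IHab := is_mono_bracket (@pivot_systemP K) (ldeg_parity a) (ldeg_parity b)
    IHa IHb.
  apply: eq_is_mono IHab => // u _.
  rewrite /ldeg -big_split; apply: eq_bigr => i _ /=.
  by rewrite PoszD mulrDr.
- apply: eq_is_mono (is_mono_sqr (@pivot_systemP K) IHa) => // u _.
  rewrite /ldeg mulr_sumr; apply: eq_bigr => i _ /=.
  by rewrite PoszM; ring.
Qed.

End LieMonomials.

Theorem theorem7p2 (K : fieldType) (n1 n2 n3 : nat) :
  dim_le1 (@Qgr K n1 n2 n3).
Proof.
(* The multidegree (n1, n2, n3) as seen by the functional with values u 0, u 1, u 2 on the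
   generators. *)
pose delta (u : nat -> int) := u 0%N * n1%:Z + u 1%N * n2%:Z + u 2%N * n3%:Z.
have [W WP] := is_mono_line (@pivot_systemP K) delta.
exists W => _ [s [sP ->]].
suff [c cE] : exists c : K, forall f, \sum_(p <- s) p.1 *: leval p.2 f = c *: W f.
  by exists c; apply: functional_extensionality.
elim: s sP => [_|[b e] s IH /= /andP[/and4P[_ /eqP e1 /eqP e2 /eqP e3] /IH[c cE]]].
  by exists 0 => f; rewrite big_nil scale0r.
have [|a aE] := WP (leval e).
  apply: eq_is_mono (leval_is_mono K e) => // u _.
  have -> : ldeg e u = u 0%N * (lcount 0 e)%:Z + u 1%N * (lcount 1 e)%:Z
      + u 2%N * (lcount 2 e)%:Z.
    rewrite /ldeg !big_ord_recl big_ord0 addr0 addrA.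
    by congr (_ + _ * Posz (lcount _ _) + _ * Posz (lcount _ _)); apply: val_inj.
  by rewrite e1 e2 e3.
by exists (b * a + c) => f; rewrite big_cons cE aE scalerDl scalerA.
Qed.
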